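(* Let $\boldsymbol\Lambda\in\mathbb R^{N\times N}$ have non-negative off-diagonal entries, satisfy $\mathbf 1^T\boldsymbol\Lambda=\mathbf 0$, and have spectrum contained in $\{z\in\mathbb C:\operatorname{Re}(z)\le0\}$. Consider the MPRK scheme (see context) applied to the conservative problem $\mathbf y'=\boldsymbol\Lambda\mathbf y$, with Patankar-weight denominators $\pi_\nu^{(i)}=\pi_\nu^{(i)}(y_\nu^n,y_\nu^{(1)},\dots,y_\nu^{(i-1)})$ and $\sigma_\nu=\sigma_\nu(y_\nu^n,y_\nu^{(1)},\dots,y_\nu^{(s)})$ of class $\mathcal C^1$. Let $\mathbf y^*>\mathbf 0$ be a steady state, and assume $\pi_\nu^{(i)}(y_\nu^*,\dots,y_\nu^* )=y_\nu^*$ and $\sigma_\nu(y_\nu^*,\dots,y_\nu^* )=y_\nu^*$ for any steady state. Then the Jacobian at $\mathbf y^*$ of the generating map $\mathbf g$ of the scheme, $\mathbf y^{n+1}=\mathbf g(\mathbf y^n)$, is given by $$\mathbf D^*\mathbf y^{(i)}=(\mathbf I-\Delta t\,c_i\boldsymbol\Lambda)^{-1}\Bigl(\mathbf I-\Delta t\,c_i\boldsymbol\Lambda\mathbf D_n^*\boldsymbol\pi^{(i)}-\Delta t\,\boldsymbol\Lambda\sum_{l=1}^{i-1}\bigl(c_i\mathbf D_l^*\boldsymbol\pi^{(i)}-a_{il}\mathbf I\bigr)\mathbf D^*\mathbf y^{(l)}\Bigr),\quad i=1,\dots,s,$$ $$\mathbf D\mathbf g(\mathbf y^* )=(\mathbf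 I-\Delta t\,\boldsymbol\Lambda)^{-1}\Bigl(\mathbf I-\Delta t\,\boldsymbol\Lambda\mathbf D_n^*\boldsymbol\sigma-\Delta t\,\boldsymbol\Lambda\sum_{l=1}^{s}\bigl(\mathbf D_l^*\boldsymbol\sigma-b_l\mathbf I\bigr)\mathbf D^*\mathbf y^{(l)}\Bigr).$$
   Context: The MPRK (modified Patankar--Runge--Kutta) scheme is based on an explicit $s$-stage Runge--Kutta method with non-negative coefficients $a_{ij},b_j$, $\sum_j a_{ij}=c_i$, $\sum_j b_j=1$. Applied to the conservative linear problem $\mathbf y'=\boldsymbol\Lambda\mathbf y$ (viewed as a production-destruction system with $p_{ij}(\mathbf y)=d_{ji}(\mathbf y)=\lambda_{ij}y_j$ for $i\ne j$, $p_{ii}=d_{ii}=0$), it reads, for $\mathbf y^n>\mathbf 0$ and $\Delta t>0$, $$\mathbf y^{(i)}=\mathbf y^n+\Delta t\sum_{j=1}^{i-1}a_{ij}\boldsymbol\Lambda\operatorname{diag}(\mathbf y^{(j)})\operatorname{diag}(\boldsymbol\pi^{(i)})^{-1}\mathbf y^{(i)},\ i=1,\dots,s,\qquad \mathbf y^{n+1}=\mathbf y^n+\Delta t\sum_{j=1}^{s}b_{j}\boldsymbol\Lambda\operatorname{diag}(\mathbf y^{(j)})\operatorname{diag}(\boldsymbol\sigma)^{-1}\mathbf y^{n+1},$$ with $\boldsymbol\pi^{(i)}=(\pi^{(i)}_1,\dots,\pi_N^{(i)})^T>\mathbf 0$ and $\boldsymbol\sigma=(\sigma_1,\dots,\sigma_N)^T>\mathbf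 0$, and $\mathbf 1=(1,\dots,1)^T$. Notation: $\mathbf D_n^*\boldsymbol\pi^{(i)}$ and $\mathbf D_l^*\boldsymbol\pi^{(i)}$ are the Jacobians of $\boldsymbol\pi^{(i)}$ with respect to its argument $\mathbf y^n$, respectively $\mathbf y^{(l)}$ (all arguments treated as independent), evaluated with all arguments equal to $\mathbf y^*$; similarly $\mathbf D_n^*\boldsymbol\sigma,\mathbf D_l^*\boldsymbol\sigma$. $\mathbf D^*\mathbf y^{(i)}$ is the Jacobian at $\mathbf y^n=\mathbf y^*$ of the map $\mathbf y^n\mapsto\mathbf y^{(i)}(\mathbf y^n)$. *)

(* Defs.v *)
From HB Require Import structures.
From mathcomp Require Import all_boot all_order all_algebra.
From mathcomp Require Import complex.
From mathcomp Require Import all_classical all_reals all_analysis.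

Set Implicit Arguments.
Unset Strict Implicit.
Unset Printing Implicit Defensive.
Import Order.TTheory GRing.Theory Num.Theory.
Import numFieldNormedType.Exports.
Local Open Scope ring_scope.
Local Open Scope classical_set_scope.

Definition positive_mx (R : realType) (m n : nat) : set 'M[R]_(m, n) :=
  [set v | forall i j, 0 < v i j].

(* For column vectors; the library's [jacobian] acts on row vectors and is
   therefore the transpose of the usual Jacobian matrix. *)
Definition cjacobian (R : realType) (m n : nat)
    (f : 'cV[R]_n -> 'cV[R]_m) (p : 'cV[R]_n) : 'M[R]_(m, n) :=
  \matrix_(i, j) ('d f p (delta_mx j 0) : 'cV[R]_m) i 0.

Lemma diff_cjacobian (R : realType) (m n : nat)
    (f : 'cV[R]_n -> 'cV[R]_m) (p v : 'cV[R]_n) :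
  'd f p v = cjacobian f p *m v.
Proof.
rewrite {1}(matrix_sum_delta v) linear_sum /=.
apply/matrixP => i k; rewrite ord1 summxE mxE; apply: eq_bigr => j _.
by rewrite big_ord1 linearZ /= !mxE mulrC.
Qed.

(* Class C^1 on an open set A: in finite dimension, pointwise continuity of
   the differential is continuity of all the partial derivatives. *)
Definition C1_on (R : realType) (m : nat) (A : set 'rV[R]_m)
    (f : 'rV[R]_m -> R) : Prop :=
  (forall w, A w -> differentiable (f : 'rV[R]_m -> R^o) w) /\
  (forall v w, A w ->
     {for w, continuous (fun w' => ('d (f : 'rV[R]_m -> R^o) w' v : R))}).

Definition spectrum_Re_le0 (R : realType) (N : nat) (L : 'M[R]_N) : Prop :=
  forall z : R[i], eigenvalue (map_mx (real_complex R) L) z -> complex.Re z <= 0.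

Definition explicit_rk (R : realType) (s : nat)
    (a : 'M[R]_s) (b c : 'I_s -> R) : Prop :=
  [/\ forall i j : 'I_s, (i <= j)%N -> a i j = 0,
      forall i j, 0 <= a i j,
      forall j, 0 <= b j,
      forall i, \sum_j a i j = c i
    & \sum_j b j = 1].

(* The stages preceding stage i are indexed by 'I_i. *)
Definition prev_stage (s : nat) (i : 'I_s) (j : 'I_i) : 'I_s :=
  widen_ord (ltnW (ltn_ord i)) j.

(* A family of k + 1 vectors of R^N is stored as an N x (1 + k) matrix: column
   0 is y^n, the following ones are y^(1), ..., y^(k).  A weight denominator
   for the component nu is a function of row nu only. *)
Definition weight_args (R : realType) (N k : nat)
    (y : 'cV[R]_N) (Y : 'I_k -> 'cV[R]_N) : 'M[R]_(N, 1 + k) :=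
  row_mx y (\matrix_(nu, l) Y l nu 0).

Definition weight (R : realType) (N k : nat)
    (p : 'I_N -> 'rV[R]_(1 + k) -> R) (W : 'M[R]_(N, 1 + k)) : 'cV[R]_N :=
  \col_nu p nu (row nu W).

(* D_n^* p and D_l^* p: only the argument in question varies. *)
Definition weight_jac_n (R : realType) (N k : nat)
    (p : 'I_N -> 'rV[R]_(1 + k) -> R) (ystar : 'cV[R]_N) : 'M[R]_N :=
  cjacobian (fun x => weight p (weight_args x (fun=> ystar))) ystar.

Definition weight_jac (R : realType) (N k : nat)
    (p : 'I_N -> 'rV[R]_(1 + k) -> R) (l : 'I_k) (ystar : 'cV[R]_N) : 'M[R]_N :=
  cjacobian (fun x => weight p
    (weight_args ystar (fun j => if j == l then x else ystar))) ystar.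

Definition diagc (R : realType) (N : nat) (v : 'cV[R]_N) : 'M[R]_N :=
  diag_mx v^T.

(* y = y^n, Y i = y^(i+1), y1 = y^(n+1); both systems are linearly implicit. *)
Definition mprk_step (R : realType) (N s : nat) (L : 'M[R]_N)
    (a : 'M[R]_s) (b : 'I_s -> R) (dt : R)
    (pi : forall i : 'I_s, 'I_N -> 'rV[R]_(1 + i) -> R)
    (sigma : 'I_N -> 'rV[R]_(1 + s) -> R)
    (y : 'cV[R]_N) (Y : 'I_s -> 'cV[R]_N) (y1 : 'cV[R]_N) : Prop :=
  (forall i : 'I_s,
     Y i = y + dt *: \sum_(j < i) a i (prev_stage j) *:
       (L *m diagc (Y (prev_stage j))
          *m invmx (diagc (weight (pi i) (weight_args y (fun l => Y (prev_stage l)))))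
          *m Y i)) /\
  y1 = y + dt *: \sum_(j < s) b j *:
    (L *m diagc (Y j) *m invmx (diagc (weight sigma (weight_args y Y))) *m y1).

(* Main.v *)
Require Import Defs.
From HB Require Import structures.
From mathcomp Require Import all_boot all_order all_algebra.
From mathcomp Require Import complex.
From mathcomp Require Import all_classical all_reals all_analysis.
From mathcomp Require Import ring.
Set Implicit Arguments.
Unset Strict Implicit.
Unset Printing Implicit Defensive.
Import Order.TTheory GRing.Theory Num.Theory.
Import numFieldNormedType.Exports.
Local Open Scope ring_scope.
Local Open Scope classical_set_scope.

(** Every stage, and likewise the final update, is one linear system
      z = y + t L diag(q(y)) z,    q_nu = sum_l al_l (Y_l)_nu / w_nu,
    whose matrix M(y) = I - t L diag(q(y)) depends on y through the previous
    stages Y_l and the weight denominators w.  At the steady state x all the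
    Y_l and w equal x, so every q_nu is the constant gam = sum_l al_l and
    M(x) = I - t gam L.  This matrix is invertible because a kernel vector
    would make 1 / (t gam) > 0 an eigenvalue of L ([resolvent_unitmx]).  Hence

    - z(x) = x, since L x = 0 makes x a solution of the system at x;
    - near x the matrix M(y) stays invertible, and Cramer's rule
      z(y) = adj(M(y)) y / det(M(y)) shows that z is differentiable at x;
    - once z is known to be differentiable, differentiating the system gives
        (I - t gam L) z' v = v + t L (q'(v) x)     (componentwise product),
      which is [diagonal_solve_diff].

    By the quotient rule, q'_nu(v) x_nu = sum_l al_l (Y_l' v)_nu - gam w'_nu(v).
    The chain rule and the linearity of the differential of the weights split
    w'(v) as D_n w v + sum_l D_l w (Y_l' v) ([weight_jac_sum]); inserting this
    gives the formula for one implicit system, [stage_jacobian].  The theorem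
    follows by induction on the stages: those preceding stage i are
    differentiable with value x at x, and gam is c_i for stage i, 1 for the
    final update. *)

(** * Differentiability of matrix-valued maps *)

Section diff_lemmas.
Context {R : realType} {V : normedModType R}.

(** Differentiability is local: the difference of the two maps vanishes near
    [x], so it is little-o of the increment and has differential 0. *)
Lemma near_eq_differentiable (W : normedModType R) (f g : V -> W) (x : V) :
  (\forall y \near x, f y = g y) -> differentiable f x -> differentiable g x.
Proof.
move=> fg df; have -> : g = f + (g - f).
  by apply/funext => y; rewrite /= !fctE addrC subrK.
apply: differentiableD => //.
have gf0 : (g - f) x = 0 by rewrite !fctE (nbhs_singleton fg) subrr.
have e : (g - f) \o shift x = cst ((g - f) x) + cst 0 +o_ 0 id.
  apply/eqaddoP => _ /posnumP[e]; rewrite gf0 addr0.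
  have : \forall h \near (0 : V), (g - f) (h + x) = 0.
    move: fg; rewrite [X in X -> _](near_shift 0) subr0.
    apply: filterS => h /= fgh.
    by rewrite !fctE fgh subrr.
  move=> fg0; near=> h.
  have -> : ((g - f) \o shift x - cst 0) h = 0.
    by rewrite [LHS]subr0 /=; near: h.
  by rewrite normr0 mulr_ge0.
apply/diff_locallyP; suff -> : 'd (g - f) x = 0 :> (V -> W).
  by split => //; apply: cst_continuous.
by apply/diff_unique => //; apply: cst_continuous.
Unshelve. all: by end_near. Qed.

Lemma differentiable_mx m n (F : V -> 'M[R]_(m, n)) (x : V) :
  (forall i j, differentiable (fun y => F y i j) x) -> differentiable F x.
Proof.
move=> dF.
have -> : F =
    \sum_(i < m) \sum_(j < n) (fun y => F y i j *: delta_mx i j).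
  apply/funext => y; rewrite fct_sumE [LHS]matrix_sum_delta.
  by apply: eq_bigr => i _; rewrite fct_sumE.
by do 2!(apply: differentiable_sum => ?); apply: differentiableZl.
Qed.

Lemma is_diff_mx m n (F dF : V -> 'M[R]_(m, n)) (x : V) :
  (forall i j, is_diff x (fun y => F y i j) (fun v => dF v i j)) ->
  is_diff x F dF.
Proof.
move=> dFij; have dfF : differentiable F x.
  by apply: differentiable_mx => i j; exact: ex_diff.
apply: DiffDef => //; apply/funext => v.
rewrite -deriveE // derive_mx; last exact: diff_derivable.
apply/matrixP => i j; rewrite mxE deriveE; last exact: ex_diff.
by rewrite diff_val.
Qed.

Lemma is_diff_coord m n (F dF : V -> 'M[R]_(m, n)) (x : V) i j :
  is_diff x F dF -> is_diff x (fun y => F y i j) (fun v => dF v i j).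
Proof.
move=> dFx.
have dFij : differentiable (fun y => F y i j) x.
  by apply: (@differentiable_comp _ _ _ _ F (fun M : 'M[R]_(m, n) => M i j));
    [exact: ex_diff | exact: differentiable_coord].
apply: DiffDef => //; apply/funext => v; rewrite -deriveE //.
have -> : dF v = 'D_v F x by rewrite deriveE ?diff_val //; exact: ex_diff.
by rewrite derive_mx ?mxE //; apply: diff_derivable; exact: ex_diff.
Qed.

Lemma differentiable_bigsum (I : Type) (r : seq I) (P : pred I)
    (f : I -> V -> R) (x : V) :
  (forall i, P i -> differentiable (f i) x) ->
  differentiable (fun y => \sum_(i <- r | P i) f i y) x.
Proof.
move=> df; rewrite (_ : (fun _ => _) = \sum_(i <- r | P i) f i); last first.
  by apply/funext => y; rewrite fct_sumE.
elim/big_ind : _ => //.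
by move=> ? ? g h; apply: differentiableD.
Qed.

Lemma differentiable_bigprod (I : Type) (r : seq I) (f : I -> V -> R) (x : V) :
  (forall i, differentiable (f i) x) ->
  differentiable (fun y => \prod_(i <- r) f i y) x.
Proof.
move=> df; elim: r => [|i r IH].
  by under eq_fun do rewrite big_nil; exact: differentiable_cst.
by under eq_fun do rewrite big_cons; exact: differentiableM.
Qed.

Lemma differentiable_det n (M : V -> 'M[R]_n) (x : V) :
  (forall i j, differentiable (fun y => M y i j) x) ->
  differentiable (fun y => \det (M y)) x.
Proof.
move=> dM; apply: differentiable_bigsum => s _.
apply: differentiableM; first exact: differentiable_cst.
exact: differentiable_bigprod.
Qed.

Lemma differentiable_adj n (M : V -> 'M[R]_n) (x : V) i j :
  (forall i j, differentiable (fun y => M y i j) x) ->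
  differentiable (fun y => (\adj (M y)) i j) x.
Proof.
move=> dM; under eq_fun do rewrite mxE /cofactor.
apply: differentiableM; first exact: differentiable_cst.
by apply: differentiable_det => k l; under eq_fun do rewrite !mxE.
Qed.

End diff_lemmas.

Lemma near_positive_mx (R : realType) m n (x : 'M[R]_(m, n)) :
  positive_mx x -> \forall y \near x, positive_mx y.
Proof.
move=> x0; have x0' i j : nbhs x (fun y : 'M[R]_(m, n) => 0 < y i j).
  by have /cvgr_gt := @coord_continuous R m n i j x; apply.
refine (@filter_forall _ _
  (fun i => [set y : 'M[R]_(m, n) | forall j, 0 < y i j]) (nbhs x) _ _) => i.
refine (@filter_forall _ _
  (fun j => [set y : 'M[R]_(m, n) | 0 < y i j]) (nbhs x) _ _) => j.
exact: x0'.
Qed.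

(** * The implicit linear systems *)

Lemma mulmx_col_inj (R : realType) m n (A B : 'M[R]_(m, n)) :
  (forall v : 'cV[R]_n, A *m v = B *m v) -> A = B.
Proof.
move=> AB; apply/matrixP => i j.
by have /colP/(_ i) := AB (delta_mx j 0); rewrite -!colE !mxE.
Qed.

(** A vector v with v = t v L would exhibit 1 / t > 0 as an eigenvalue. *)
Lemma resolvent_unitmx (R : realType) N (L : 'M[R]_N) (t : R) :
  spectrum_Re_le0 L -> 0 <= t -> 1%:M - t *: L \in unitmx.
Proof.
move=> Lspec t0; rewrite unitmxE unitfE; apply/negP => /det0P[v vn0].
rewrite mulmxBr mulmx1 -scalemxAr => /eqP; rewrite subr_eq0 => /eqP vL.
have tn0 : t != 0.
  by apply: contra_neq vn0 => t0'; rewrite vL t0' scale0r.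
have tgt0 : 0 < t by rewrite lt0r tn0.
have : eigenvalue (map_mx (real_complex R) L) (real_complex R t^-1).
  apply/eigenvalueP; exists (map_mx (real_complex R) v); last first.
    by rewrite map_mx_eq0.
  by rewrite -map_mxM -map_mxZ {2}vL scalerA mulVf // scale1r.
by move/Lspec => /=; rewrite leNgt invr_gt0 tgt0.
Qed.

(** For nonzero denominators the Patankar term is L applied to a componentwise
    quotient times z, which is the form amenable to scalar calculus. *)
Lemma patankar_termE (R : realType) N (L : 'M[R]_N) (u v z : 'cV[R]_N) :
  (forall k, v k 0 != 0) ->
  L *m diagc u *m invmx (diagc v) *m z =
  L *m \col_k (u k 0 / v k 0 * z k 0).
Proof.
move=> vn0; have -> : invmx (diagc v) = diag_mx (\row_k (v k 0)^-1).
  set w := diag_mx _.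
  have wv : w *m diagc v = 1%:M.
    rewrite /w /diagc mulmx_diag -diag_const_mx; congr diag_mx.
    by apply/rowP => k; rewrite !mxE mulVf.
  have [_ vu] := mulmx1_unit wv.
  by rewrite -[invmx _]mul1mx -wv mulmxK.
rewrite -!mulmxA; congr (_ *m _); apply/colP => k.
by rewrite !mul_diag_mx !mxE mulrA.
Qed.

(** The implicit function theorem for a linear system with matrix
    M(y) = I - t L diag(q(y)): Cramer's rule supplies differentiability of the
    solution, after which the equation itself is differentiated. *)
Lemma diagonal_solve_diff (R : realType) (N : nat) (L : 'M[R]_N) (t gam : R)
    (q : 'I_N -> 'cV[R]_N -> R) (z : 'cV[R]_N -> 'cV[R]_N) (x : 'cV[R]_N) :
  1%:M - (t * gam) *: L \in unitmx -> L *m x = 0 ->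
  (forall k, differentiable (q k) x) -> (forall k, q k x = gam) ->
  (\forall y \near x, z y = y + t *: (L *m \col_k (q k y * z y k 0))) ->
  [/\ z x = x, differentiable z x &
    forall v, (1%:M - (t * gam) *: L) *m 'd z x v =
              v + t *: (L *m \col_k ('d (q k) x v * x k 0))].
Proof.
move=> Munit Lx dq qx zE.
pose M y : 'M[R]_N := 1%:M - t *: (L *m diag_mx (\row_k q k y)).
have Mx : M x = 1%:M - (t * gam) *: L.
  rewrite /M -scalerA -[gam *: L]mul_mx_scalar -[gam%:M]diag_const_mx.
  by congr (1%:M - t *: (L *m diag_mx _)); apply/rowP => k; rewrite !mxE qx.
have MzE : \forall y \near x, M y *m z y = y.
  apply: filterS zE => y zy; rewrite /M mulmxBl mul1mx -scalemxAl -mulmxA.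
  rewrite [X in _ - t *: (L *m X)](_ : _ = \col_k (q k y * z y k 0)).
    by rewrite {1}zy addrK.
  by apply/colP => k; rewrite mul_diag_mx !mxE.
have zx : z x = x.
  have Mxx : M x *m x = x.
    by rewrite Mx mulmxBl mul1mx -scalemxAl Lx scaler0 subr0.
  by apply: (can_inj (mulKmx Munit)); rewrite -Mx Mxx (nbhs_singleton MzE).
have dM i j : differentiable (fun y => M y i j) x.
  under eq_fun do rewrite /M mul_mx_diag !mxE.
  apply: differentiableB; first exact: differentiable_cst.
  apply: differentiableM; first exact: differentiable_cst.
  by apply: differentiableM => //; exact: differentiable_cst.
have ddet := differentiable_det dM.
have dz : differentiable z x.
  (* the solution by Cramer's rule *)
  pose u y : 'cV[R]_N :=
    \col_i ((\det (M y))^-1 * \sum_j \adj (M y) i j * y j 0).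
  apply: (@near_eq_differentiable _ _ _ u).
    have detx : \det (M x) != 0 by rewrite Mx -unitfE -unitmxE.
    have detn0 : \forall y \near x, \det (M y) != 0.
      exact: (cvgr_neq0 _ (differentiable_continuous ddet)).
    near=> y; have dety : \det (M y) != 0 by near: y.
    apply/colP => i; rewrite mxE.
    have -> : \sum_j \adj (M y) i j * y j 0 = (\adj (M y) *m y) i 0.
      by rewrite mxE.
    have My : M y *m z y = y by near: y.
    by rewrite -(congr1 (mulmx (\adj (M y))) My) mulmxA mul_adj_mx
      mul_scalar_mx mxE mulKf.
  apply: differentiable_mx => i j; under eq_fun do rewrite mxE.
  apply: differentiableM.
    by apply: differentiableV => //; rewrite Mx -unitfE -unitmxE.
  apply: differentiable_bigsum => j0 _; apply: differentiableM.
    exact: differentiable_adj.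
  exact: differentiable_coord.
split => // v.
have dzv i : is_derive x v (fun y => z y i 0) ('d z x v i 0).
  have := is_diff_coord i 0 (differentiableP dz) => dzi.
  have -> : 'd z x v i 0 = 'd (fun y => z y i 0) x v.
    by rewrite [in RHS]diff_val.
  by rewrite -deriveE; [apply/derivableP/diff_derivable|]; exact: ex_diff.
have dqv k : is_derive x v (q k) ('d (q k) x v).
  by rewrite -deriveE //; exact/derivableP/diff_derivable.
have dzE : 'd z x v =
    v + t *: (L *m \col_k ('d (q k) x v * x k 0 + gam * 'd z x v k 0)).
  apply/colP => i; rewrite !mxE.
  have dyi : is_derive x v (fun y : 'cV[R]_N => y i 0 : R) (v i 0).
    have := is_diff_coord i 0 (is_diff_id x) => di.
    have -> : v i 0 = 'd (fun y : 'cV[R]_N => y i 0 : R) x v.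
      by rewrite diff_val.
    by rewrite -deriveE; [apply/derivableP/diff_derivable|]; exact: ex_diff.
  (* the product rule on the right-hand side of the equation for z *)
  have dr : is_derive x v ((fun y : 'cV[R]_N => y i 0 : R) +
      t *: \sum_k (L i k *: (q k * (fun y => z y k 0))))
    (v i 0 + t *: \sum_k
      (L i k *: (q k x *: 'd z x v k 0 + z x k 0 *: 'd (q k) x v))).
    apply: is_deriveD; apply: is_deriveZ; apply: is_derive_sum => k.
    by apply: is_deriveZ; apply: is_deriveM.
  have : is_derive x v (fun y => z y i 0)
    (v i 0 + t *: \sum_k
      (L i k *: (q k x *: 'd z x v k 0 + z x k 0 *: 'd (q k) x v))).
    apply: near_eq_is_derive dr; apply: filterS zE => y zy.
    rewrite [in RHS]zy !fctE !mxE fct_sumE; congr (_ + t * _).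
    by apply: eq_bigr => k _; rewrite !mxE.
  move=> dzi; rewrite -[LHS](@derive_val _ _ _ _ _ _ _ (dzv i)) derive_val.
  congr (_ + t * _); apply: eq_bigr => k _; rewrite !mxE qx zx addrC.
  by rewrite [x k 0 *: _]mulrC.
rewrite mulmxBl mul1mx -scalemxAl {1}dzE.
have -> : \col_k ('d (q k) x v * x k 0 + gam * 'd z x v k 0) =
   \col_k ('d (q k) x v * x k 0) + gam *: 'd z x v.
  by apply/colP => k; rewrite !mxE.
by rewrite mulmxDr scalerDr -scalemxAr scalerA addrA addrK.
Unshelve. all: by end_near. Qed.

(** * Derivatives of the Patankar weights *)

Section weights.
Context {R : realType} {V : normedModType R} {N k : nat}.

Lemma is_diff_weight_args (A dA : V -> 'cV[R]_N) (B dB : 'I_k -> V -> 'cV[R]_N)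
    (x : V) :
  is_diff x A dA -> (forall l, is_diff x (B l) (dB l)) ->
  is_diff x (fun y => weight_args (A y) (fun l => B l y))
            (fun v => weight_args (dA v) (fun l => dB l v)).
Proof.
move=> dAx dBx; apply: is_diff_mx => i j.
have E (f : V -> 'cV[R]_N) (g : 'I_k -> V -> 'cV[R]_N) :
    (fun y => weight_args (f y) (fun l => g l y) i j) =
    match fintype.split j with
    | inl j => fun y => f y i j
    | inr l => fun y => g l y i 0
    end.
  apply/funext => y; rewrite mxE; case: (fintype.split j) => // l.
  by rewrite mxE.
by rewrite !E; case: (fintype.split j) => l; apply: is_diff_coord.
Qed.

Lemma is_diff_weight (p : 'I_N -> 'rV[R]_(1 + k) -> R)
    (W dW : V -> 'M[R]_(N, 1 + k)) (x : V) :
  (forall nu, differentiable (p nu) (row nu (W x))) -> is_diff x W dW ->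
  is_diff x (fun y => weight p (W y))
    (fun v => \col_nu 'd (p nu) (row nu (W x)) (row nu (dW v))).
Proof.
move=> dp dWx; apply: is_diff_mx => nu j.
have drow : is_diff x (fun y => row nu (W y)) (fun v => row nu (dW v)).
  apply: is_diff_mx => i l; have E (f : V -> 'M[R]_(N, 1 + k)) :
    (fun y => row nu (f y) i l) = (fun y => f y nu l).
    by apply/funext => y; rewrite mxE.
  by rewrite !E; apply: is_diff_coord.
have -> : (fun y => weight p (W y) nu j) = p nu \o (fun y => row nu (W y)).
  by apply/funext => y; rewrite mxE.
have -> :
  (fun v => (\col_nu0 'd (p nu0) (row nu0 (W x)) (row nu0 (dW v))) nu j) =
    'd (p nu) (row nu (W x)) \o (fun v => row nu (dW v)).
  by apply/funext => y; rewrite mxE.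
apply: is_diff_comp => //; exact: differentiableP.
Qed.

End weights.

Section weight_jacobians.
Context {R : realType} {N k : nat} (p : 'I_N -> 'rV[R]_(1 + k) -> R).
Context (x : 'cV[R]_N).

Lemma row_weight_args_const nu :
  row nu (weight_args x (fun _ : 'I_k => x)) = const_mx (x nu 0).
Proof.
apply/rowP => j; rewrite !mxE.
by case: (fintype.split j) => l; [rewrite ord1 | rewrite mxE].
Qed.

(** One chain rule for the three maps that are needed: all arguments varying
    with y (the scheme), only y^n varying ([weight_jac_n]), only y^(l) varying
    ([weight_jac]).  At [x] they have the same argument list, so the same
    differential of [p] occurs in each. *)
Lemma is_diff_weight_steady (A dA : 'cV[R]_N -> 'cV[R]_N)
    (B dB : 'I_k -> 'cV[R]_N -> 'cV[R]_N) :
  (forall nu, differentiable (p nu) (const_mx (x nu 0))) ->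
  A x = x -> (forall l, B l x = x) ->
  is_diff x A dA -> (forall l, is_diff x (B l) (dB l)) ->
  is_diff x (fun y => weight p (weight_args (A y) (fun l => B l y)))
    (fun v => \col_nu 'd (p nu) (const_mx (x nu 0))
                (row nu (weight_args (dA v) (fun l => dB l v)))).
Proof.
move=> dp Ax Bx dAx dBx.
have ABx : weight_args (A x) (fun l => B l x) = weight_args x (fun=> x).
  by rewrite Ax; congr weight_args; apply/funext.
have rowE nu : row nu (weight_args (A x) (fun l => B l x)) = const_mx (x nu 0).
  by rewrite ABx row_weight_args_const.
set W := fun y => weight_args (A y) (fun l => B l y).
have -> : (fun v => \col_nu 'd (p nu) (const_mx (x nu 0))
      (row nu (weight_args (dA v) (fun l => dB l v)))) =
    (fun v => \col_nu 'd (p nu) (row nu (W x))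
      (row nu (weight_args (dA v) (fun l => dB l v)))).
  by apply/funext => v; apply/colP => nu; rewrite [LHS]mxE [RHS]mxE rowE.
apply: (@is_diff_weight _ _ _ _ p W); first by move=> nu; rewrite rowE.
exact: is_diff_weight_args.
Qed.

Lemma weight_jac_n_mul (v : 'cV[R]_N) :
  (forall nu, differentiable (p nu) (const_mx (x nu 0))) ->
  weight_jac_n p x *m v = \col_nu 'd (p nu) (const_mx (x nu 0))
    (row nu (weight_args v (fun=> 0))).
Proof.
move=> dp; rewrite -diff_cjacobian.
by case: (@is_diff_weight_steady id id (fun _ => cst x) (fun _ => 0) dp erefl
  (fun _ => erefl) (is_diff_id x) (fun _ => is_diff_cst x x)) => _ ->.
Qed.

Lemma weight_jac_mul l (u : 'cV[R]_N) :
  (forall nu, differentiable (p nu) (const_mx (x nu 0))) ->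
  weight_jac p l x *m u = \col_nu 'd (p nu) (const_mx (x nu 0))
    (row nu (weight_args 0 (fun j => if j == l then u else 0))).
Proof.
move=> dp; rewrite -diff_cjacobian.
have := @is_diff_weight_steady (cst x) 0
  (fun j y => if j == l then y else x) (fun j v => if j == l then v else 0).
case=> // [j|j|_ ->//]; first by case: eqP.
by case: eqP => _; [exact: is_diff_id | exact: is_diff_cst].
Qed.

(** The total derivative of the weights is the sum of the partial ones: the
    increment of the whole argument list is the sum of its restrictions to the
    single arguments, and a differential is additive. *)
Lemma weight_jac_sum (v : 'cV[R]_N) (u : 'I_k -> 'cV[R]_N) :
  (forall nu, differentiable (p nu) (const_mx (x nu 0))) ->
  \col_nu 'd (p nu) (const_mx (x nu 0)) (row nu (weight_args v u)) =
  weight_jac_n p x *m v + \sum_l weight_jac p l x *m u l.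
Proof.
move=> dp; apply/colP => nu; rewrite [LHS]mxE [RHS]mxE summxE.
have -> : (weight_jac_n p x *m v) nu 0 = 'd (p nu) (const_mx (x nu 0))
    (row nu (weight_args v (fun=> 0))).
  by rewrite weight_jac_n_mul // [LHS]mxE.
rewrite (eq_bigr (fun l => 'd (p nu) (const_mx (x nu 0))
    (row nu (weight_args 0 (fun j => if j == l then u l else 0))))); last first.
  by move=> l _; rewrite weight_jac_mul // [LHS]mxE.
rewrite -linear_sum -linearD; congr ('d _ _ _).
apply/rowP => j; rewrite !mxE summxE.
under eq_bigr do rewrite !mxE.
case: (fintype.split j) => [j0|l].
  by rewrite big1 ?addr0 // => l _; rewrite mxE.
under eq_bigr do rewrite !mxE.
rewrite !mxE add0r (bigD1 l) //= eqxx big1 ?addr0 // => l' l'l.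
by rewrite eq_sym (negPf l'l) mxE.
Qed.

End weight_jacobians.

(** * One implicit stage *)

(** Both formulas of the theorem are instances: [gam] is c_i for stage i and 1
    for the final update. *)
Lemma stage_jacobian (R : realType) (N k : nat) (L : 'M[R]_N) (t gam : R)
    (al : 'I_k -> R) (p : 'I_N -> 'rV[R]_(1 + k) -> R)
    (Y : 'I_k -> 'cV[R]_N -> 'cV[R]_N) (z : 'cV[R]_N -> 'cV[R]_N)
    (x : 'cV[R]_N) :
  1%:M - (t * gam) *: L \in unitmx -> L *m x = 0 -> positive_mx x ->
  \sum_l al l = gam ->
  (forall nu, differentiable (p nu) (const_mx (x nu 0))) ->
  (forall nu, p nu (const_mx (x nu 0)) = x nu 0) ->
  (forall l, differentiable (Y l) x) -> (forall l, Y l x = x) ->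
  (\forall y \near x, z y = y + t *: \sum_l al l *:
    (L *m diagc (Y l y)
       *m invmx (diagc (weight p (weight_args y (fun l => Y l y)))) *m z y)) ->
  [/\ z x = x, differentiable z x &
    cjacobian z x = invmx (1%:M - (t * gam) *: L) *m
      (1%:M - (t * gam) *: (L *m weight_jac_n p x)
       - t *: (L *m \sum_l (gam *: weight_jac p l x - (al l)%:M)
                 *m cjacobian (Y l) x))].
Proof.
move=> Munit Lx x0 sal dp px dY Yx zE.
pose w y := weight p (weight_args y (fun l => Y l y)).
pose dw (v : 'cV[R]_N) := weight_jac_n p x *m v +
  \sum_l weight_jac p l x *m (cjacobian (Y l) x *m v).
have wx : w x = x.
  apply/colP => nu; rewrite mxE.
  rewrite (_ : weight_args x _ = weight_args x (fun=> x)); last first.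
    by congr weight_args; apply/funext.
  by rewrite row_weight_args_const px.
have wdiff : is_diff x w dw.
  have -> : dw = (fun v => \col_nu 'd (p nu) (const_mx (x nu 0))
      (row nu (weight_args v (fun l => 'd (Y l) x v)))).
    apply/funext => v; rewrite weight_jac_sum // /dw.
    by congr (_ + _); apply: eq_bigr => l _; rewrite diff_cjacobian.
  exact: (is_diff_weight_steady dp (erefl : id x = x) Yx (is_diff_id x)
    (fun l => differentiableP (dY l))).
have xn0 nu : x nu 0 != 0 by rewrite gt_eqF.
pose q nu y := \sum_l al l * (Y l y nu 0 / w y nu 0).
have dwk nu : is_diff x (fun y => w y nu 0) (fun v => dw v nu 0).
  exact: is_diff_coord.
have dYk l nu :
  is_diff x (fun y => Y l y nu 0) (fun v => (cjacobian (Y l) x *m v) nu 0).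
  apply: (@is_diff_coord _ _ _ _ (Y l) (mulmx (cjacobian (Y l) x))).
  have -> : mulmx (cjacobian (Y l) x) = 'd (Y l) x :> (_ -> 'cV[R]_N).
    by apply/funext => v; rewrite diff_cjacobian.
  exact: differentiableP.
have dwV nu : differentiable (fun y => (w y nu 0)^-1) x.
  by apply: differentiableV; [exact: ex_diff | rewrite wx].
have dYw l nu : differentiable (fun y => Y l y nu 0 / w y nu 0) x.
  by apply: differentiableM => //; exact: ex_diff.
have dq nu : differentiable (q nu) x.
  apply: differentiable_bigsum => l _.
  by apply: differentiableM; [exact: differentiable_cst | exact: dYw].
have qx nu : q nu x = gam.
  rewrite /q -sal; apply: eq_bigr => l _.
  by rewrite Yx wx divff // mulr1.
(* the quotient rule for Y / w at a point where Y = w = r *)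
have quotE (c r e f : R) : r != 0 ->
    c * (r * (- r ^- 2 * f) + r^-1 * e) * r = c * e - c * f.
  by move=> rn0; field.
have dqE nu v : 'd (q nu) x v * x nu 0 =
    \sum_l al l * (cjacobian (Y l) x *m v) nu 0 - gam * dw v nu 0.
  have -> : q nu = \sum_l (al l *: (fun y => Y l y nu 0 / w y nu 0)).
    by apply/funext => y; rewrite fct_sumE.
  rewrite -deriveE; last first.
    by apply: differentiable_sum => l; exact: differentiableZ.
  rewrite derive_sum; last first.
    by move=> l; apply/diff_derivable/differentiableZ.
  rewrite mulr_suml -sal mulr_suml -sumrB; apply: eq_bigr => l _.
  rewrite deriveZ; last exact: diff_derivable.
  rewrite deriveM; [|exact/diff_derivable/ex_diff|exact: diff_derivable].
  rewrite deriveV ?wx //; last by apply/diff_derivable; exact: ex_diff.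
  rewrite !deriveE; [|exact: ex_diff|exact: ex_diff].
  have -> : 'd (fun y => w y nu 0) x v = dw v nu 0 by rewrite diff_val.
  have -> : 'd (fun y => Y l y nu 0) x v = (cjacobian (Y l) x *m v) nu 0.
    by rewrite diff_val.
  by rewrite Yx; exact: quotE.
have [|zx dz dzE] := @diagonal_solve_diff _ _ L t gam q z x Munit Lx dq qx.
  have wnear : \forall y \near x, positive_mx (w y).
    have wc : {for x, continuous w}.
      by apply: differentiable_continuous; exact: ex_diff.
    by apply: wc; rewrite wx; exact: near_positive_mx.
  near=> y; rewrite {1}(near zE y) //.
  have wy0 nu : w y nu 0 != 0 by rewrite gt_eqF // (near wnear y).
  congr (_ + t *: _); under eq_bigr do rewrite patankar_termE // scalemxAr.
  rewrite -mulmx_sumr; congr (_ *m _); apply/colP => nu.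
  rewrite summxE mxE mulr_suml; apply: eq_bigr => l _.
  by rewrite [LHS]mxE [X in al l * X = _]mxE mulrA.
(* It remains to compare the two Jacobians after multiplication by
   I - t gam L, on every vector v. *)
split => //; apply: (can_inj (mulKmx Munit)); rewrite mulKVmx //.
apply: mulmx_col_inj => v; rewrite -mulmxA -diff_cjacobian dzE.
have -> : \col_nu ('d (q nu) x v * x nu 0) =
    \sum_l al l *: (cjacobian (Y l) x *m v) - gam *: dw v.
  apply/colP => nu; rewrite [LHS]mxE dqE [RHS]mxE summxE.
  congr (_ + _); last by rewrite [RHS]mxE [in RHS]mxE.
  by apply: eq_bigr => l _; rewrite [RHS]mxE.
rewrite !mulmxBl mul1mx -!scalemxAl -!mulmxA -addrA; congr (_ + _).
rewrite -scalerA -opprD -scalerDr -[in RHS]scalerN; congr (t *: _).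
rewrite scalemxAr -mulmxDr -mulmxN; congr (_ *m _).
rewrite mulmx_suml.
have -> :
   \sum_l ((gam *: weight_jac p l x - (al l)%:M) *m cjacobian (Y l) x *m v) =
   gam *: (\sum_l weight_jac p l x *m (cjacobian (Y l) x *m v)) -
   \sum_l al l *: (cjacobian (Y l) x *m v).
  rewrite scaler_sumr -sumrB; apply: eq_bigr => l _.
  by rewrite -mulmxA mulmxBl -scalemxAl mul_scalar_mx.
by rewrite /dw scalerDr !opprD opprK addrC addrA.
Unshelve. all: by end_near. Qed.

(** * The scheme *)

Lemma sum_prev_stages (R : realType) (s : nat) (a : 'M[R]_s) (i : 'I_s) :
  (forall i j : 'I_s, (i <= j)%N -> a i j = 0) ->
  \sum_j a i j = \sum_(j < i) a i (prev_stage j).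
Proof.
move=> a0; rewrite -(big_ord_narrow (F := a i) (ltnW (ltn_ord i))) /=.
rewrite (bigID (fun j : 'I_s => (j < i)%N)) /= [X in _ + X]big1 ?addr0 // => j.
by rewrite -leqNgt => /a0.
Qed.

Theorem theorem5p11 (R : realType) (N s : nat) (L : 'M[R]_N)
    (a : 'M[R]_s) (b c : 'I_s -> R) (dt : R)
    (pi : forall i : 'I_s, 'I_N -> 'rV[R]_(1 + i) -> R)
    (sigma : 'I_N -> 'rV[R]_(1 + s) -> R)
    (Y : 'I_s -> 'cV[R]_N -> 'cV[R]_N) (g : 'cV[R]_N -> 'cV[R]_N)
    (ystar : 'cV[R]_N)
    (L_offdiag : forall i j : 'I_N, i != j -> 0 <= L i j)
    (L_conservative : (const_mx 1 : 'rV[R]_N) *m L = 0)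
    (L_spectrum : spectrum_Re_le0 L)
    (rk : explicit_rk a b c)
    (dt_gt0 : 0 < dt)
    (pi_gt0 : forall (i : 'I_s) nu w, positive_mx w -> 0 < pi i nu w)
    (sigma_gt0 : forall nu w, positive_mx w -> 0 < sigma nu w)
    (pi_C1 : forall (i : 'I_s) nu, C1_on (@positive_mx R 1 (1 + i)) (pi i nu))
    (sigma_C1 : forall nu, C1_on (@positive_mx R 1 (1 + s)) (sigma nu))
    (scheme : forall y : 'cV[R]_N, positive_mx y ->
       mprk_step L a b dt pi sigma y (fun i => Y i y) (g y))
    (pi_steady : forall y : 'cV[R]_N, positive_mx y -> L *m y = 0 ->
       forall (i : 'I_s) nu, pi i nu (const_mx (y nu 0)) = y nu 0)
    (sigma_steady : forall y : 'cV[R]_N, positive_mx y -> L *m y = 0 ->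
       forall nu, sigma nu (const_mx (y nu 0)) = y nu 0)
    (ystar_gt0 : positive_mx ystar)
    (ystar_steady : L *m ystar = 0) :
  (forall i : 'I_s,
     differentiable (Y i) ystar /\
     cjacobian (Y i) ystar =
       invmx (1%:M - (dt * c i) *: L) *m
       (1%:M - (dt * c i) *: (L *m weight_jac_n (pi i) ystar)
        - dt *: (L *m \sum_(l < i)
            (c i *: weight_jac (pi i) l ystar - (a i (prev_stage l))%:M)
              *m cjacobian (Y (prev_stage l)) ystar))) /\
  differentiable g ystar /\
  cjacobian g ystar =
    invmx (1%:M - dt *: L) *m
    (1%:M - dt *: (L *m weight_jac_n sigma ystar)
     - dt *: (L *m \sum_(l < s)
         (weight_jac sigma l ystar - (b l)%:M) *m cjacobian (Y l) ystar)).
Proof.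
have [a0 age0 _ sumc sumb] := rk.
have cge0 i : 0 <= c i by rewrite -sumc; apply: sumr_ge0 => j _.
have dpi (i : 'I_s) nu : differentiable (pi i nu) (const_mx (ystar nu 0)).
  by apply: (pi_C1 i nu).1 => k l; rewrite mxE.
have dsigma nu : differentiable (sigma nu) (const_mx (ystar nu 0)).
  by apply: (sigma_C1 nu).1 => k l; rewrite mxE.
have ypos := near_positive_mx ystar_gt0.
have stage (i : 'I_s) :
    (forall l : 'I_i, differentiable (Y (prev_stage l)) ystar) ->
    (forall l : 'I_i, Y (prev_stage l) ystar = ystar) -> _ :=
  fun dY Yx => stage_jacobian
    (resolvent_unitmx L_spectrum (mulr_ge0 (ltW dt_gt0) (cge0 i)))
    ystar_steady ystar_gt0 (etrans (esym (sum_prev_stages i a0)) (sumc i))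
    (dpi i) (pi_steady ystar ystar_gt0 ystar_steady i) dY Yx
    (@filterS _ _ (nbhs_filter ystar) _ _ (fun y y0 => (scheme y y0).1 i) ypos).
(* strong induction: stage i only involves the stages before it *)
have stages n (i : 'I_s) :
    (i < n)%N -> Y i ystar = ystar /\ differentiable (Y i) ystar.
  elim: n i => // n IHn i; rewrite ltnS => lein.
  have IHi (l : 'I_i) := IHn (prev_stage l) (leq_trans (ltn_ord l) lein).
  by have [] := stage i (fun l => (IHi l).2) (fun l => (IHi l).1).
have Yx i := (stages _ i (ltn_ord i)).1.
have dY i := (stages _ i (ltn_ord i)).2.
split; first by move=> i; have [] := stage i (fun l => dY _) (fun l => Yx _).
have t1 : 0 <= dt * 1 by rewrite mulr1 ltW.
have [_ dg ->] := stage_jacobian (resolvent_unitmx L_spectrum t1)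
  ystar_steady ystar_gt0 sumb dsigma (sigma_steady ystar ystar_gt0 ystar_steady)
  dY Yx (@filterS _ _ (nbhs_filter ystar) _ _ (fun y y0 => (scheme y y0).2)
    ypos).
split => //; rewrite mulr1; congr (_ *m (_ - dt *: (L *m _))).
by apply: eq_bigr => l _; rewrite scale1r.
Qed.
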